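(* If a ballean $\mathcal B=(X,P,B)$ is cellular, then its hyperballean $\exp\mathcal B$ is cellular.
   Context: A ballean is a triple $(X,P,B)$ where $X,P$ are sets, $P\ne\emptyset$, and $B\colon X\times P\to\mathcal P(X)$ satisfies: $x\in B(x,\alpha)$; $x\in B(y,\alpha)$ iff $y\in B(x,\alpha)$; and for all $\alpha,\beta\in P$ there is $\gamma\in P$ such that $B(B(x,\alpha),\beta)\subseteq B(x,\gamma)$ for every $x\in X$, where $B(A,\delta)=\bigcup_{y\in A}B(y,\delta)$. A map $f\colon X\to Y$ between balleans $(X,P_X,B_X)$ and $(Y,P_Y,B_Y)$ is bornologous if for every $\alpha\in P_X$ there is $\beta\in P_Y$ with $f(B_X(x,\alpha))\subseteq B_Y(f(x),\beta)$ for all $x\in X$. Two ballean structures on the same support $X$ are identified (written $=$) if the identity map of $X$ is bornologous in both directions. For a ballean $(X,P,B)$ put $B^1(x,\alpha)=B(x,\alpha)$, $B^{n+1}(x,\alpha)=B(B^n(x,\alpha),\alpha)$ and $B^{\square}(x,\alpha)=\bigcup_{n\ge1}B^n(x,\alpha)$. Then $\mathcal B^\square=(X,P,B^\square)$ is a ballean, and $\mathcal B$ is called cellular if $\mathcal B=\mathcal B^\square$ (i.e. for every $\alpha\in P$ there is $\beta\in P$ with $B^\square(x,\alpha)\subseteq B(x,\beta)$ for all $x\in X$). The hyperballean of $\mathcal B=(X,P,B)$ is $\exp\mathcal B=(\exp X,P,\exp B)$, where $\exp X$ is the set of non-empty subsets of $X$ and $\exp B(Y,\alpha)=\{Z\in\exp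 X: Z\subseteq B(Y,\alpha),\ Y\subseteq B(Z,\alpha)\}$. *)

(* Defs.v *)
From mathcomp Require Import all_boot.
From mathcomp Require Import boolp classical_sets.

Set Implicit Arguments.
Unset Strict Implicit.
Unset Printing Implicit Defensive.

Local Open Scope classical_set_scope.

(* The union of the balls of radius [a] centred at the points of [A]; used with
   several ball maps, hence stated for a bare [B]. *)
Definition ball_set (X P : Type) (B : X -> P -> set X) (A : set X) (a : P) :
  set X := \bigcup_(y in A) B y a.

Record ballean (X : Type) := Ballean {
  radius : Type;
  ball : X -> radius -> set X;
  radius_inhabited : inhabited radius;
  ball_refl : forall x a, ball x a x;
  ball_sym : forall x y a, ball y a x <-> ball x a y;
  ball_mul : forall a b, exists c, forall x,
    ball_set ball (ball x a) b `<=` ball x c }.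

Definition bornologous (X Y : Type) (BX : ballean X) (BY : ballean Y)
  (f : X -> Y) : Prop :=
  forall a : radius BX, exists b : radius BY, forall x,
    f @` ball x a `<=` ball (f x) b.

(* Balleans on [X] are only ever compared up to this relation, never by [=]. *)
Definition ballean_eq (X : Type) (B1 B2 : ballean X) : Prop :=
  bornologous B1 B2 id /\ bornologous B2 B1 id.

Section Square.
Variables (X : Type) (B : ballean X).

(* The index is shifted by one: [ball_iter x a n] is $B^{n+1}(x,a)$. *)
Fixpoint ball_iter (x : X) (a : radius B) (n : nat) : set X :=
  if n is m.+1 then ball_set (@ball X B) (ball_iter x a m) a else ball x a.

Definition square_ball (x : X) (a : radius B) : set X :=
  \bigcup_n ball_iter x a n.

Lemma square_step x a y z :
  square_ball x a y -> ball y a z -> square_ball x a z.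
Proof. by move=> [n _ xy] yz; exists n.+1 => //; exists y. Qed.

Lemma square_sub x a (Q : set X) : Q x ->
  (forall y z, Q y -> ball y a z -> Q z) -> square_ball x a `<=` Q.
Proof.
move=> Qx QS z [n _]; elim: n z => [|n IH] z /=; first exact: QS.
by move=> [y /IH Qy]; exact: QS.
Qed.

Lemma square_refl x a : square_ball x a x.
Proof. by exists 0 => //; exact: ball_refl. Qed.

Lemma square_trans x y z a :
  square_ball x a y -> square_ball y a z -> square_ball x a z.
Proof. by move=> xy; apply: (@square_sub _ _ (square_ball x a)) => // u v; exact: square_step. Qed.

Lemma square_sym1 x y a : square_ball y a x -> square_ball x a y.
Proof.
apply: (@square_sub _ _ [set u | square_ball u a y]) => [|u v uy uv] /=.
   exact: square_refl.
apply: (square_trans _ uy); exists 0 => //=; exact/ball_sym.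
Qed.

Lemma square_sym x y a : square_ball y a x <-> square_ball x a y.
Proof. by split; exact: square_sym1. Qed.

Lemma square_mono x a c : (forall y, ball y a `<=` ball y c) ->
  square_ball x a `<=` square_ball x c.
Proof.
move=> ac; apply: square_sub => [|u v xu /ac]; first exact: square_refl.
exact: square_step.
Qed.

Lemma square_mul (a b : radius B) : exists c, forall x,
  ball_set square_ball (square_ball x a) b `<=` square_ball x c.
Proof.
have [c abc] := ball_mul a b; exists c => x z [y xy yz].
apply: (@square_trans _ y).
  apply: square_mono xy => u v uv; apply: abc; exists v => //; exact: ball_refl.
apply: square_mono yz => u v uv; apply: abc; exists u => //; exact: ball_refl.
Qed.

Definition square : ballean X :=
  Ballean (radius_inhabited B) square_refl square_sym square_mul.

End Square.

Definition cellular (X : Type) (B : ballean X) : Prop := ballean_eq B (square B).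

Definition expset (X : Type) : Type := {Y : set X | Y !=set0}.

Section Hyperballean.
Variables (X : Type) (B : ballean X).

Definition exp_ball (Y : expset X) (a : radius B) : set (expset X) :=
  [set Z | sval Z `<=` ball_set (@ball X B) (sval Y) a /\
           sval Y `<=` ball_set (@ball X B) (sval Z) a].

Lemma exp_refl Y a : exp_ball Y a Y.
Proof. by split => x Yx; exists x => //; exact: ball_refl. Qed.

Lemma exp_sym Y Z a : exp_ball Z a Y <-> exp_ball Y a Z.
Proof. by split=> -[]. Qed.

Lemma exp_mul (a b : radius B) : exists c, forall Y,
  ball_set exp_ball (exp_ball Y a) b `<=` exp_ball Y c.
Proof.
have [c abc] := ball_mul a b; exists c => Y W [Z [ZY YZ] [WZ ZW]]; split.
  move=> w /WZ[z /ZY[y Yy yz] zw]; exists y => //.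
  by apply: abc; exists z.
move=> y /YZ[z /ZW[w Ww wz] zy]; exists w => //.
by apply/ball_sym/abc; exists z; exact/ball_sym.
Qed.

Definition hyperballean : ballean (expset X) :=
  Ballean (radius_inhabited B) exp_refl exp_sym exp_mul.

End Hyperballean.

(* Main.v *)
Require Import Defs.
From mathcomp Require Import all_boot.
From mathcomp Require Import classical_sets.

(** Closeness of two sets for the Hausdorff-type balls of the hyperballean means
    that each point of either set is close to a point of the other.  Along a
    chain [Y = Y0, Y1, ..., Yn = Z] of successively [a]-close sets, every point
    of [Y] can therefore be followed to a point of [Z] through a chain of
    [a]-close points, and conversely.  So chains in the hyperballean of [B] are
    absorbed by single steps in the hyperballean of [square B]
    ([square_hyperball_sub]).  If [B] is cellular, [a]-chains of points lie in
    [b]-balls for a [b] that depends on [a] only, and this uniform bound passes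
    to sets ([hyperball_mono]). *)

Set Implicit Arguments.
Unset Strict Implicit.
Unset Printing Implicit Defensive.

Local Open Scope classical_set_scope.

Lemma ball_sub_square (X : Type) (B : ballean X) (x : X) (a : radius B) :
  ball x a `<=` square_ball x a.
Proof. by move=> y xy; exists 0. Qed.

Lemma cellularP (X : Type) (B : ballean X) :
  cellular B <->
  forall a : radius B, exists b : radius B, forall x,
    square_ball x a `<=` ball x b.
Proof.
split=> [[_ sqB] a|sqB].
  have [b ab] := sqB a; exists b => x y xy.
  by apply: ab; exists y.
split=> a.
  by exists a => x _ [y xy <-]; exact: ball_sub_square.
have [b ab] := sqB a; exists b => x _ [y xy <-]; exact: ab.
Qed.

(** The two balleans on [X] are unrelated here, so that the lemma can compare
    [square B] with [B]. *)
Lemma hyperball_mono (X : Type) (B1 B2 : ballean X)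
    (a : radius B1) (b : radius B2) :
  (forall x, ball x a `<=` ball x b) ->
  forall Y : expset X, exp_ball Y a `<=` exp_ball Y b.
Proof.
move=> ab Y Z [ZY YZ]; split=> x.
  by move=> /ZY[y Yy /ab]; exists y.
by move=> /YZ[z Zz /ab]; exists z.
Qed.

(** By [square_sub] it is enough that the [a]-ball around [Y] in the hyperballean
    of [square B] is stable under one more [a]-step of the hyperballean of [B].
    Such a step adds one link to each chain of points: at the end of a chain that
    starts in [Y], and at the start of a chain that ends in [Y]. *)
Lemma square_hyperball_sub (X : Type) (B : ballean X) (Y : expset X)
    (a : radius B) :
  @square_ball _ (hyperballean B) Y a `<=` @exp_ball _ (square B) Y a.
Proof.
apply: square_sub => [|Z W [ZY YZ] [WZ ZW]]; first exact: exp_refl.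
split.
  move=> w /WZ[z /ZY[y Yy yz] zw]; exists y => //.
  exact: square_step yz zw.
move=> y /YZ[z /ZW[w Ww wz] zy]; exists w => //.
exact: square_trans (ball_sub_square wz) zy.
Qed.

Theorem proposition2p3 (X : Type) (B : ballean X) (hB : cellular B) :
  cellular (hyperballean B).
Proof.
apply/cellularP => a; have [b ab] := (cellularP B).1 hB a.
exists b => Y Z /square_hyperball_sub.
exact: (@hyperball_mono _ (square B) B).
Qed.
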